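(* Let $X$ be a compact space with $\chi(X)\le\aleph_0$ which is a coset space of a subgroup of a product of Čech-complete groups (or on which there is a continuous transitive $d$-open action of a subgroup of a product of Čech-complete groups). Then $X$ is metrizable.
   Context: Compact spaces are Hausdorff. $X$ is a coset space of a topological group $G$ if it is homeomorphic to $G/K$ (quotient topology) for some closed subgroup $K$. An action of $G$ on $X$ is $d$-open if $x\in\operatorname{Int}(\operatorname{cl}(Ox))$ for every $x\in X$ and every neighborhood $O$ of the unit. ''Subgroup of a product of Čech-complete groups'' means a topological subgroup of a product of Čech-complete topological groups. *)

(* Defs.v *)
From HB Require Import structures.
From mathcomp Require Import all_boot all_order all_algebra.
From mathcomp Require Import all_classical all_reals.
From mathcomp Require Import topology_theory.topology function_spaces.
From mathcomp Require Import Rstruct Rstruct_topology.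
Set Implicit Arguments. Unset Strict Implicit. Unset Printing Implicit Defensive.
Import Order.TTheory GRing.Theory Num.Theory.
Local Open Scope classical_set_scope.
Local Open Scope ring_scope.

Record topGroup := TopGroup {
  tg_car :> topologicalType;
  tg_mul : tg_car -> tg_car -> tg_car;
  tg_inv : tg_car -> tg_car;
  tg_one : tg_car;
  tg_mulA : forall a b c, tg_mul a (tg_mul b c) = tg_mul (tg_mul a b) c;
  tg_mul1 : forall a, tg_mul tg_one a = a;
  tg_mulV : forall a, tg_mul (tg_inv a) a = tg_one;
  tg_mul_cont : continuous (fun p : tg_car * tg_car => tg_mul p.1 p.2);
  tg_inv_cont : continuous tg_inv }.

Definition cech_complete (X : topologicalType) : Prop :=
  exists (K : topologicalType) (e : X -> K),
    [/\ compact [set: K], hausdorff_space K, injective e, continuous e &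
        (forall U : set X, open U -> exists V : set K, open V /\ e @^-1` V = U)]
    /\ closure (range e) = [set: K]
    /\ (exists W : nat -> set K, (forall n, open (W n)) /\
                                  range e = \bigcap_n W n).

Definition subgroup_of_prod_cech (G : topGroup) : Prop :=
  exists (I : Type) (F : I -> topGroup)
         (f : G -> prod_topology (fun i => tg_car (F i))),
    [/\ forall i, cech_complete (F i),
        forall a b i, f (tg_mul a b) i = tg_mul (f a i) (f b i),
        injective f, continuous f &
        forall U : set G, open U ->
          exists V : set (prod_topology (fun i => tg_car (F i))),
            open V /\ f @^-1` V = U].

Definition closed_subgroup (G : topGroup) (K : set G) : Prop :=
  [/\ K (tg_one G), (forall a b, K a -> K b -> K (tg_mul a b)),
      (forall a, K a -> K (tg_inv a)) & closed K].

(** X is homeomorphic to the left coset space G/K (quotient topology) for some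
    closed subgroup K of G: q is the quotient map g |-> gK. *)
Definition coset_space_of (X : topologicalType) (G : topGroup) : Prop :=
  exists (K : set G) (q : G -> X),
    [/\ closed_subgroup K, (forall x : X, exists g, q g = x),
        (forall a b, q a = q b <-> K (tg_mul (tg_inv a) b)) &
        (forall U : set X, open U <-> open (q @^-1` U))].

Definition cont_trans_dopen_action (G : topGroup) (X : topologicalType) : Prop :=
  exists act : G -> X -> X,
    [/\ (forall x, act (tg_one G) x = x),
        (forall a b x, act (tg_mul a b) x = act a (act b x)),
        continuous (fun p : G * X => act p.1 p.2),
        (forall x y, exists g, act g x = y) &
        (forall (x : X) (O : set G), nbhs (tg_one G) O ->
           interior (closure [set act g x | g in O]) x)].

Definition countable_character (X : topologicalType) : Prop :=
  forall x : X, exists B : set (set X),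
    [/\ countable B, (forall b, B b -> open b /\ b x) &
        (forall N, nbhs x N -> exists2 b, B b & b `<=` N)].

Definition metrizable (X : topologicalType) : Prop :=
  exists d : X -> X -> Rdefinitions.R,
    [/\ (forall x y, 0 <= d x y), (forall x y, d x y = 0 <-> x = y),
        (forall x y, d x y = d y x),
        (forall x y z, d x z <= d x y + d y z) &
        (forall U : set X, open U <->
           forall x, U x -> exists2 e : Rdefinitions.R, 0 < e & [set y | d x y < e] `<=` U)].

(* Main.v *)
From HB Require Import structures.
Require Import Defs.
From mathcomp Require Import all_boot all_order all_algebra.
From mathcomp Require Import all_classical all_reals.
From mathcomp Require Import topology_theory.topology function_spaces.
From mathcomp Require Import Rstruct Rstruct_topology normedtype lra.
Set Implicit Arguments. Unset Strict Implicit. Unset Printing Implicit Defensive.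
Import Order.TTheory GRing.Theory Num.Theory numFieldNormedType.Exports.
Local Open Scope classical_set_scope.
Local Open Scope ring_scope.

(** A coset space carries an open, hence d-open, transitive action, so let [G]
    act d-openly and transitively on [X], and fix [x0] in [X].  A countable base
    at [x0] only involves a countable set [A] of coordinates of the product; let
    [N] be the filter of those neighbourhoods of the unit of [G] that are
    determined by finitely many coordinates in [A].  Conjugation and transitivity
    make the action pointwise continuous for [N], and d-openness then makes it
    jointly continuous for [N].

    Cech-completeness of the factors yields a sequence [P n] in [N] such that the
    sets [P n x0] shrink to [x0] and every ultrafilter on [G] containing all the
    [P n] is [N]-Cauchy.  By a closing-off argument one builds finite sets
    [L n] of [G], increasing in [n], such that, with [W n] the intersection of
    the conjugates [s P_j s^-1] for [s] in [L n] and [j < n], the sets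
    [cl (W n t x0)] for [t] in [L n.+1] have interiors that cover [X].  An
    ultrafilter containing all the [W n] is Cauchy and its limit fixes every
    [s x0], [s] in some [L n]; from this the countably many sets
    [int (cl (W n t x0))], [t] in [L n.+1], form a base of [X], and a second
    countable compact Hausdorff space is metrizable. *)

Local Notation R := Rdefinitions.R.

(** * Metrization of compact spaces with a countable base *)

Section separating_sequence_metric.
Variables (X : topologicalType) (f : nat -> X -> R).
Hypotheses (f_cont : forall n, continuous (f n))
           (f01 : forall n x, 0 <= f n x <= 1)
           (closed1 : forall x : X, closed [set x])
           (f_sep : forall x U, open U -> U x ->
              exists n, f n x = 0 /\ forall y, ~ U y -> f n y = 1).

(** A supremum replaces the usual series: the weights tend to 0, so only finitely many terms can
    exceed a given positive bound. *)
Let D x y := [set n.+1%:R^-1 * `|f n x - f n y| | n in [set: nat]].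
Let d x y : R := sup (D x y).

Let D_le1 x y n : n.+1%:R^-1 * `|f n x - f n y| <= n.+1%:R^-1.
Proof.
rewrite ler_piMr ?invr_ge0 // ler_norml.
by have := f01 n x; have := f01 n y; move=> /andP[? ?] /andP[? ?]; lra.
Qed.

Let D_ub x y : has_ubound (D x y).
Proof.
exists 1 => _ [n _ <-]; apply: le_trans (D_le1 _ _ _) _.
by rewrite invf_le1 // ler1n.
Qed.

Let D_le x y n : n.+1%:R^-1 * `|f n x - f n y| <= d x y.
Proof. by apply: ub_le_sup; [exact: D_ub | exists n]. Qed.

Let d_le x y c : (forall n, n.+1%:R^-1 * `|f n x - f n y| <= c) -> d x y <= c.
Proof.
move=> h; apply: ge_sup.
  by exists (1%:R^-1 * `|f 0%N x - f 0%N y|); exists 0%N.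
by move=> _ [n _ <-].
Qed.

Let d_ge0 x y : 0 <= d x y.
Proof. by apply: le_trans (D_le x y 0); rewrite mulr_ge0 // invr_ge0. Qed.

Let d_ball_nbhs x e : 0 < e -> nbhs x [set y | d x y < e].
Proof.
move=> e0; have e20 : 0 < e / 2 by rewrite divr_gt0.
have [N NP] : exists N : nat, N.+1%:R^-1 < e / 2.
  exists (Num.truncn (e / 2)^-1).
  by rewrite invf_plt ?posrE // truncnS_gt.
have : nbhs x [set y | forall n : 'I_N, `|f n x - f n y| < e / 2].
  by apply: filter_forall => n;
    exact: (@f_cont n x _ (nbhsx_ballx (f n x) (e / 2) e20)).
(* Terms of index below [N] are small by continuity, the others by their weight; the bound [e / 2]
   keeps the supremum strictly below [e]. *)
apply: filterS => y hy; apply: le_lt_trans (_ : e / 2 < e); last by lra.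
apply: d_le => n; have [nN|Nn] := ltnP n N.
  apply: le_trans (ltW (hy (Ordinal nN))).
  by rewrite ler_piMl // invf_le1 // ler1n.
apply: le_trans (D_le1 _ _ _) _; apply: le_trans (ltW NP).
by rewrite lef_pV2 ?posrE // ler_nat.
Qed.

Lemma separating_sequence_metrizable : metrizable X.
Proof.
have dball x (U : set X) : open U -> U x ->
    exists2 e : R, 0 < e & [set y | d x y < e] `<=` U.
  move=> oU Ux; have [n [fx fU]] := f_sep oU Ux.
  (* Outside [U] the term of index [n] equals this radius. *)
  exists n.+1%:R^-1; first by rewrite invr_gt0.
  move=> y /= dy; apply: contrapT => nUy.
  have := D_le x y n; rewrite fx (fU _ nUy) sub0r normrN1 mulr1.
  by rewrite leNgt dy.
exists d; split => //.
- move=> x y; split=> [dxy|->]; last first.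
    apply/eqP; rewrite eq_le d_ge0 andbT; apply: d_le => n.
    by rewrite subrr normr0 mulr0.
  apply: contrapT => nxy.
  have [|e e0] := dball x (~` [set y]) _ nxy; first exact: closed_openC.
  by move=> /(_ y); rewrite /= dxy => /(_ e0); exact.
- move=> x y; congr sup; apply/seteqP; split=> _ [n _ <-]; exists n => //;
  by rewrite distrC.
- move=> x y z; apply: d_le => n; apply: le_trans (lerD (D_le x y n) (D_le y z n)).
  by rewrite -mulrDr ler_wpM2l ?invr_ge0 // ler_distD.
- move=> U; split=> [oU x Ux|h]; first exact: dball.
  by rewrite openE => x /h[e e0 eU]; exact: filterS eU (d_ball_nbhs x e0).
Qed.
End separating_sequence_metric.

(** Pairs of basic sets with [closure (b i)] inside [b j] have Urysohn functions, and regularity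
    provides enough such pairs to separate points from closed sets. *)
Lemma compact_countable_base_metrizable (X : topologicalType) (b : nat -> set X) :
  compact [set: X] -> hausdorff_space X ->
  (forall n, open (b n)) ->
  (forall x U, open U -> U x -> exists2 n, b n x & b n `<=` U) ->
  metrizable X.
Proof.
move=> Xc Xh b_open b_base.
have Xn : normal_space X by exact: compact_normal.
(* The other pairs do no harm: [Urysohn] is continuous with values in [0, 1] for arbitrary sets. *)
pose f k : X -> R := let ij := odflt (0, 0)%N (unpickle k) in
  Urysohn (closure (b ij.1)) (~` b ij.2).
apply: (@separating_sequence_metrizable X f).
- by move=> n; exact: Urysohn_continuous.
- move=> n x; suff : range (f n) `<=` `[0, 1].
    by move=> /(_ (f n x)); rewrite /= in_itv /=; apply; exists x.
  exact: Urysohn_range.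
- exact/accessible_closed_set1/hausdorff_accessible.
move=> x U oU Ux; have [j bjx bjU] := b_base x U oU Ux.
have [|V Vx Vbj] := @compact_regular X x setT Xh Xc filterT (b j).
  by apply: open_nbhs_nbhs; split => //; exact: b_open.
have [i bix biV] := b_base x V° (open_interior V) Vx.
have sep : uniform_separator (closure (b i)) (~` b j).
  apply: normal_uniform_separator => //; first exact: closed_closure.
    exact: open_closedC.
  apply/disjoints_subset; rewrite setCK; apply: subset_trans Vbj.
  by apply: closureS; apply: subset_trans biV _; exact: interior_subset.
exists (pickle (i, j)); rewrite /f pickleK /=; split.
  by apply: (Urysohn_sub0 sep); exists x => //; exact: subset_closure.
by move=> y nUy; apply: (Urysohn_sub1 sep); exists y => // /bjU.
Qed.

(** * Group identities and consequences of compactness *)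

Section topGroup_theory.
Variable G : topGroup.
Implicit Types a b c : G.

Lemma tg_mulKl a b : tg_mul (tg_inv a) (tg_mul a b) = b.
Proof. by rewrite tg_mulA tg_mulV tg_mul1. Qed.

Lemma tg_mulVr a : tg_mul a (tg_inv a) = tg_one G.
Proof.
rewrite -[LHS]tg_mul1 -{1}(tg_mulV (tg_inv a)) -tg_mulA.
by rewrite (tg_mulA (tg_inv a) a) tg_mulV tg_mul1 tg_mulV.
Qed.

Lemma tg_mulr1 a : tg_mul a (tg_one G) = a.
Proof. by rewrite -(tg_mulV a) tg_mulA tg_mulVr tg_mul1. Qed.

Lemma tg_mulKr a b : tg_mul a (tg_mul (tg_inv a) b) = b.
Proof. by rewrite tg_mulA tg_mulVr tg_mul1. Qed.

Lemma tg_inv_unique a b : tg_mul a b = tg_one G -> a = tg_inv b.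
Proof. by move=> ab1; rewrite -[a]tg_mulr1 -(tg_mulVr b) tg_mulA ab1 tg_mul1. Qed.

Lemma tg_idem a : tg_mul a a = a -> a = tg_one G.
Proof. by move=> aa; rewrite -(tg_mulKl a a) aa tg_mulV. Qed.

End topGroup_theory.

Lemma compact_regular_nbhs (X : topologicalType) (x : X) (U : set X) :
  compact [set: X] -> hausdorff_space X -> nbhs x U ->
  exists2 V : set X, nbhs x V & closure V `<=` U.
Proof.
by move=> Xc Xh /(@compact_regular X x setT Xh Xc filterT)[V Vx VU]; exists V.
Qed.

(** The image of an ultrafilter converges to each of its cluster points, and compactness provides
    one. *)
Lemma compact_ultra_image_cvg (T : Type) (X : topologicalType)
    (F : set_system T) (h : T -> X) :
  compact [set: X] -> UltraFilter F -> exists x : X, h @ F --> x.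
Proof.
move=> Xc FU; have [x [_ hx]] := Xc (h @ F) _ filterT.
exists x => U Ux; have [//|nU] := in_ultra_setVsetC (h @^-1` U) FU.
by have [y []] := hx (~` U) U nU Ux.
Qed.

(** * A countable base from a d-open action *)

Section second_countability.
Variables (G : topGroup) (X : topologicalType) (act : G -> X -> X).
Variables (N : set_system G) (x0 : X) (P : nat -> set G).

Local Notation "a * b" := (tg_mul a b).
Local Notation "a ^-1" := (tg_inv a).
Local Notation orb O x := [set act g x | g in O].

Hypotheses (Xc : compact [set: X]) (Xh : hausdorff_space X).
Hypotheses (act1 : forall x, act (tg_one G) x = x)
           (actM : forall a b x, act (a * b) x = act a (act b x))
           (act_cont : forall g, continuous (act g))
           (act_trans : forall x, exists g, act g x0 = x).
Hypotheses (NF : Filter N)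
           (N_mul : forall O, N O ->
              exists2 O', N O' & forall a b, O' a -> O' b -> O (a * b))
           (N_conj : forall g O, N O -> N [set a | O (g^-1 * (a * g))])
           (N_dopen : forall x O, N O -> interior (closure (orb O x)) x).
(** [P_cauchy] speaks of ultrafilters on [G * X] because the limits of a moving point and of its
    translate are compared along a single ultrafilter. *)
Hypotheses (PN : forall n, N (P n))
           (P_small : forall U, nbhs x0 U ->
              exists n, forall g, P n g -> U (act g x0))
           (P_cauchy : forall F : set_system (G * X), UltraFilter F ->
              (forall n, F [set p | P n p.1]) -> forall O, N O ->
              exists2 A : set G, F [set p | A p.1] &
                forall a b, A a -> A b -> O (a * b^-1)).

Let actVK g x : act g (act (g^-1) x) = x.
Proof. by rewrite -actM tg_mulVr act1. Qed.

Let act_conj g a x : act a (act g x) = act g (act (g^-1 * (a * g)) x).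
Proof. by rewrite !actM actVK. Qed.

(** Conjugation by an [h] that carries [x0] to [x] transports [P_small] from [x0] to [x]. *)
Let N_small (x : X) (U : set X) : nbhs x U ->
  exists2 O, N O & forall g, O g -> U (act g x).
Proof.
have [h <-] := act_trans x => /act_cont/P_small[n PnU].
exists [set a | P n (h^-1 * (a * h))]; first exact: N_conj.
by move=> g /PnU; rewrite (act_conj h g).
Qed.

(* Joint continuity comes for free: [O (cl (O x))] lies in [cl (O O x)], and
   [cl (O x)] is a neighbourhood of [x] by d-openness. *)
Let N_joint (x : X) (U : set X) : nbhs x U ->
  exists O (M : set X), [/\ N O, nbhs x M &
    forall g y, O g -> M y -> U (act g y)].
Proof.
move=> /(compact_regular_nbhs Xc Xh)[V Vx VU].
have [O NO OV] := N_small Vx; have [O' NO' OO] := N_mul NO.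
exists O', (closure (orb O' x)); split => //.
  exact: N_dopen NO'.
move=> g y Og yO; apply: VU => B /(act_cont) By.
have [_ [[h Oh <-] Bh]] := yO _ By.
by exists (act g (act h x)); split => //; rewrite -actM; apply/OV/OO.
Qed.

Let net O (L : seq G) := forall x, exists2 t, t \in L &
  interior (closure (orb O (act t x0))) x.

(** By transitivity and d-openness the interiors for all [t] cover [X]; compactness extracts a
    finite subcover. *)
Let net_ex : exists tau : set G -> seq G, forall O, N O -> net O (tau O).
Proof.
suff /choice [tau tauP] : forall O, exists L, N O -> net O L by exists tau.
move=> O; have [NO|] := pselect (N O); last by exists [::].
pose pX : ptopologicalType := HB.pack X (isPointed.Build X x0).
have : @compact pX setT := Xc; rewrite compact_cover.
move=> /(_ G setT (fun t => interior (closure (orb O (act t x0)))))[].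
- by move=> t _; exact: open_interior.
- move=> x _; have [t tx] := act_trans x.
  by exists t => //; rewrite tx; exact: N_dopen.
- move=> D _ XD; exists (finmap.enum_fset D) => _ x.
  by have [t tD tx] := XD x Logic.I; exists t.
Qed.

Let tau := projT1 (cid net_ex).

(** For [g] in this set, [g] moves [act s x0] to the image under [act s] of a point of the
    [P j]-orbit of [x0], hence, for suitable [j], to a point near [act s x0]. *)
Let W_ n (L : seq G) : set G :=
  [set g | forall s j, s \in L -> (j < n)%N -> P j (s^-1 * (g * s))].

(** The net chosen for [W m] enters [L m.+1], so later sets [W n] control the points of that net as
    well. Starting from the unit puts [W n.+1] inside [P n]. *)
Let Fixpoint L n : seq G :=
  if n is m.+1 then L m ++ tau (W_ m (L m)) else [:: tg_one G].

Let W n := W_ n (L n).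

Let W_N n : N (W n).
Proof.
rewrite /W; elim: (L n) => [|t l IH].
  by apply: filterS filterT => g _ s j; rewrite in_nil.
have : N [set g | forall j : 'I_n, P j (t^-1 * (g * t))].
  by apply: filter_forall => j; exact: N_conj.
apply: filterS2 IH => g gl gt s j; rewrite in_cons => /orP[/eqP ->|sl] jn.
  exact: (gt (Ordinal jn)).
exact: gl.
Qed.

Let L_mono m n : (m <= n)%N -> {subset L m <= L n}.
Proof.
elim: n => [|n IH]; first by rewrite leqn0 => /eqP ->.
rewrite leq_eqVlt => /orP[/eqP -> //|/IH h] s /h sn.
by rewrite /= mem_cat sn.
Qed.

Let W_mono m n : (m <= n)%N -> W n `<=` W m.
Proof.
move=> mn g Wg s j sL jm; apply: Wg; first exact: L_mono sL.
exact: leq_trans mn.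
Qed.

Let W_net n : net (W n) (L n.+1).
Proof.
move=> x; have [t tT tx] := projT2 (cid net_ex) _ (W_N n) x.
by exists t => //=; rewrite mem_cat tT orbT.
Qed.

Let S : set X := [set y | exists n s, s \in L n /\ y = act s x0].

(* If the limits [x] and [y] differed, the Cauchy property would keep all
   translates [a (s x0)], with [a] in a large set, near [x]; but these translates
   converge to [s x0], which is near [y]. *)
Let limits_agree (F : set_system (G * X)) (x y : X) : UltraFilter F ->
  (forall n, F [set p | W n p.1]) -> F [set p | S p.2] ->
  act p.1 p.2 @[p --> F] --> x -> p.2 @[p --> F] --> y -> x = y.
Proof.
move=> FU FW FS Fx Fy; apply: contrapT => /eqP xy.
move: Xh; rewrite open_hausdorff => /(_ _ _ xy)[[Ux Uy]] /= [].
rewrite !inE => Uxx Uyy [oUx oUy UxUy].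
have nUx : nbhs x Ux by exact: open_nbhs_nbhs.
have nUy : nbhs y Uy by exact: open_nbhs_nbhs.
have [O [M [NO nM OM]]] := N_joint nUx.
have FP n : F [set p | P n p.1].
  apply: filterS (FW n.+1) => p /(_ (tg_one G) n) /=.
  have -> : tg_inv (tg_one G) = tg_one G by rewrite -[LHS]tg_mulr1 tg_mulV.
  rewrite tg_mul1 tg_mulr1; apply => //.
  by rewrite mem_cat (@L_mono 0) //= inE.
have [A FA AO] := P_cauchy FU FP NO.
have [[b z] [[/= Ab Mb] [Uz [n [s [sL zE]]]]]] : exists p : G * X,
    (A p.1 /\ M (act p.1 p.2)) /\ Uy p.2 /\ S p.2.
  apply: (@filter_ex _ F).
  by apply: filterI; apply: filterI => //; [exact: Fx | exact: Fy].
rewrite {z}zE in Mb Uz.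
have [j Pj] : exists j, forall g, P j g -> Uy (act s (act g x0)).
  exact: (P_small (@act_cont s x0 _ (open_nbhs_nbhs (conj oUy Uz)))).
(* The index is large enough for [s] to be among the conjugating elements and for [j] to be among
   the levels. *)
have [[a z] /= [Aa Wa]] : exists p : G * X, A p.1 /\ W (maxn n j.+1) p.1.
  by apply: (@filter_ex _ F); apply: filterI => //; exact: FW.
suff : (Ux `&` Uy) (act a (act s x0)) by rewrite UxUy.
split.
  have := OM _ _ (AO _ _ Aa Ab) Mb; rewrite -actM.
  by rewrite -tg_mulA tg_mulV tg_mulr1.
rewrite act_conj; apply: Pj; apply: Wa; last exact: leq_maxr.
by apply: L_mono sL; exact: leq_maxl.
Qed.

(** This makes equality of limits uniform. If no [n] and [M] worked, the sets [B] would generate a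
    proper filter; along an ultrafilter above it [v] tends to [x], while [u] has a limit yet stays
    outside [U], so the two limits differ. *)
Let transfer (u v : G * X -> X) (x : X) (U : set X) :
  (forall F : set_system (G * X), UltraFilter F ->
     (forall n, F [set p | W n p.1]) -> F [set p | S p.2] ->
     forall y, v @ F --> x -> u @ F --> y -> x = y) ->
  nbhs x U -> exists n (M : set X), nbhs x M /\
    forall p, W n p.1 -> S p.2 -> M (v p) -> U (u p).
Proof.
move=> uv nU; apply: contrapT => /forallNP no.
pose B (i : nat * set X) := [set p | [/\ W i.1 p.1, S p.2, i.2 (v p) & ~ U (u p)]].
pose F0 := filter_from [set i : nat * set X | nbhs x i.2] B.
have F0F : Filter F0.
  apply: filter_from_filter; first by exists (0%N, setT); exact: filterT.
  move=> [m M] [n M'] /= nM nM'; exists (maxn m n, M `&` M'); first exact: filterI.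
  move=> p [/= Wp Sp [Mp Mp'] nUp]; split; split => //=.
    exact: W_mono (leq_maxl _ _) _ Wp.
  exact: W_mono (leq_maxr _ _) _ Wp.
have F0P : ProperFilter F0.
  apply: filter_from_proper => -[n M] /= nM; apply/set0P/eqP => B0.
  apply: (no n); exists M; split => // p Wp Sp Mp.
  apply: contrapT => nUp; suff : B (n, M) p by rewrite B0.
  by split.
have [F [FU F0s]] := ultraFilterLemma F0P.
have FB i : nbhs x i.2 -> F (B i) by move=> ni; apply: F0s; exists i.
have [y Fy] := compact_ultra_image_cvg u Xc FU.
have xy : x = y.
  apply: (uv F FU) => //.
  - by move=> n; apply: filterS (FB (n, setT) filterT) => p [].
  - by apply: filterS (FB (0%N, setT) filterT) => p [].
  - move=> M nM; suff : F (v @^-1` M) by [].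
    by apply: filterS (FB (0%N, M) nM) => p [].
have FnU : F (B (0%N, setT)) by apply: FB; exact: filterT.
have FUu : F (u @^-1` U) by apply: Fy; rewrite -xy.
by have [p [[]]] := filter_ex (filterI FnU FUu).
Qed.

(** [transfer] is used in both directions. As [x] lies in the closure of the [W n]-orbit of
    [act t x0], some element of [W n] brings [act t x0] into [M2]; then [act t x0] is in [M1], so
    its whole [W n]-orbit is in [V]. *)
Lemma dopen_countable_base : exists b : nat -> set X,
  (forall n, open (b n)) /\
  forall x U, open U -> U x -> exists2 n, b n x & b n `<=` U.
Proof.
(* The net for [W n] is found in [L n.+1], hence the shift. Default values still give sets of the
   same form. *)
pose b k : set X := let nm := odflt (0, 0)%N (unpickle k) in
  interior (closure (orb (W nm.1) (act (nth (tg_one G) (L nm.1.+1) nm.2) x0))).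
exists b; split=> [n|x U oU Ux]; first exact: open_interior.
have [V nV VU] := compact_regular_nbhs Xc Xh (open_nbhs_nbhs (conj oU Ux)).
have [n1 [M1 [nM1 M1V]]] : exists n (M : set X), nbhs x M /\
    forall p : G * X, W n p.1 -> S p.2 -> M p.2 -> V (act p.1 p.2).
  apply: (transfer _ nV) => F FU FW FS y Fx Fy.
  by symmetry; exact: limits_agree FW FS Fy Fx.
have [n2 [M2 [nM2 M2M1]]] : exists n (M : set X), nbhs x M /\
    forall p : G * X, W n p.1 -> S p.2 -> M (act p.1 p.2) -> M1 p.2.
  apply: (transfer _ nM1) => F FU FW FS y Fx Fy.
  exact: limits_agree FW FS Fx Fy.
pose n := maxn n1 n2; have [t tL tx] := W_net n x.
have St : S (act t x0) by exists n.+1, t.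
exists (pickle (n, index t (L n.+1))).
  by rewrite /b pickleK /= nth_index.
rewrite /b pickleK /= nth_index //.
apply: subset_trans (@interior_subset _ _) _; apply: subset_trans VU.
apply: closureS => _ [w Ww <-]; apply: (M1V (w, _)) => //=.
  exact: W_mono (leq_maxl _ _) _ Ww.
have [_ [[w' Ww' <-] Mw']] := interior_subset tx _ nM2.
apply: (M2M1 (w', _)) Mw' => //=.
exact: W_mono (leq_maxr _ _) _ Ww'.
Qed.

End second_countability.

(** * Countable sets, filters and continuity of translations *)

Lemma countable_range (T : Type) (A : set T) (a : T) :
  A a -> countable A -> exists e : nat -> T, range e = A.
Proof.
move=> Aa /pfcard_geP[A0|/unsquash e]; first by move: Aa; rewrite A0.
by exists e; exact: image_eq.
Qed.

Lemma countable_setU (T : Type) (A B : set T) :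
  countable A -> countable B -> countable (A `|` B).
Proof.
by move=> Ac Bc; rewrite -bigcup2E; apply: bigcup_countable => // -[|[|n]].
Qed.

Lemma filter_seqI (T : Type) (I : eqType) (F : set_system T) (l : seq I)
    (h : I -> set T) : Filter F ->
  (forall i, i \in l -> F (h i)) -> F [set x | forall i, i \in l -> h i x].
Proof.
move=> FF; elim: l => [|j l IH] Fh; first by apply: filterS filterT => x _ i.
have Fl := IH (fun i il => Fh i (mem_behead (s := j :: l) il)).
apply: filterS2 (Fh j (mem_head _ _)) Fl => x hj hl i.
by rewrite inE => /orP[/eqP ->|/hl].
Qed.

Lemma tg_mulr_cont (G : topGroup) (b : G) : continuous (fun a : G => tg_mul a b).
Proof.
move=> a; apply: (cvg_comp (fun a => (a, b)) (fun p => tg_mul p.1 p.2) _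
  (@tg_mul_cont G (a, b))).
by apply: cvg_pair; [exact: cvg_id | exact: cvg_cst].
Qed.

Lemma tg_mull_cont (G : topGroup) (b : G) : continuous (fun a : G => tg_mul b a).
Proof.
move=> a; apply: (cvg_comp (fun a => (b, a)) (fun p => tg_mul p.1 p.2) _
  (@tg_mul_cont G (b, a))).
by apply: cvg_pair; [exact: cvg_cst | exact: cvg_id].
Qed.

Lemma tg_mul_nbhs (G : topGroup) (a b : G) (U : set G) : nbhs (tg_mul a b) U ->
  exists A B : set G, [/\ nbhs a A, nbhs b B &
    forall c d, A c -> B d -> U (tg_mul c d)].
Proof.
move=> /(@tg_mul_cont G (a, b))[[A B] /= [nA nB] ABU].
by exists A, B; split => // c d Ac Bd; exact: (ABU (c, d)).
Qed.

Lemma tg_div_nbhs (G : topGroup) (a : G) (U : set G) : nbhs (tg_one G) U ->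
  exists2 A : set G, nbhs a A & forall c d, A c -> A d -> U (tg_mul c (tg_inv d)).
Proof.
rewrite -(tg_mulVr a) => /tg_mul_nbhs[A [B [nA nB ABU]]].
exists (A `&` tg_inv (t := G) @^-1` B).
  by apply: filterI => //; exact: tg_inv_cont nB.
by move=> c d [Ac _] [_ Bd]; exact: ABU.
Qed.

(** * Coset spaces and Cech-complete spaces *)

Lemma coset_space_action (X : topologicalType) (G : topGroup) :
  coset_space_of X G -> cont_trans_dopen_action G X.
Proof.
case=> K [q [[K1 KM KV Kc] qsurj qE qtop]].
have /choice[r rK] := qsurj.
(* The saturation of [B] is a union of right translates of [B] by elements of [K]. Openness of [q]
   later yields both continuity of the action and d-openness. *)
have q_open (B : set G) : open B -> open (q @` B).
  move=> oB; apply/qtop; rewrite openE => a [b Bb /qE Kba].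
  set k := tg_mul (tg_inv b) a in Kba.
  have akb : tg_mul a (tg_inv k) = b.
    by rewrite -[a](tg_mulKr b) -/k -tg_mulA tg_mulVr tg_mulr1.
  have nB : nbhs (tg_mul a (tg_inv k)) B by rewrite akb; exact: open_nbhs_nbhs.
  have nBk : nbhs a [set c | B (tg_mul c (tg_inv k))] by exact: tg_mulr_cont nB.
  apply: filterS nBk => c /= Bc.
  exists (tg_mul c (tg_inv k)) => //; apply/qE.
  suff -> : tg_mul (tg_inv (tg_mul c (tg_inv k))) c = k by [].
  rewrite -[X in tg_mul _ X](_ : tg_mul (tg_mul c (tg_inv k)) k = c) ?tg_mulKl //.
  by rewrite -tg_mulA tg_mulV tg_mulr1.
(* The choice of the representative [r x] is immaterial, by [actq]. *)
pose act g x := q (tg_mul g (r x)).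
have actq g a : act g (q a) = q (tg_mul g a).
  apply/qE; rewrite -[X in tg_mul _ X](_ : tg_mul (tg_mul g (r (q a)))
    (tg_mul (tg_inv (r (q a))) a) = tg_mul g a); last by rewrite -tg_mulA tg_mulKr.
  by rewrite tg_mulKl; apply/qE.
have q_nbhs a (B : set G) : nbhs a B -> nbhs (q a) (q @` B).
  move=> nB; apply: filterS (open_nbhs_nbhs (conj (q_open _ (open_interior B)) _)).
    by apply: image_subset; exact: interior_subset.
  by exists a.
have q_cont : continuous q.
  move=> a U; rewrite nbhsE => -[V [oV Va] VU].
  have : nbhs a (q @^-1` V) by apply: open_nbhs_nbhs; split => //; exact/qtop.
  by apply: filterS => b; exact: VU.
exists act; split.
- by move=> x; rewrite /act tg_mul1.
- by move=> a b x; rewrite -{1}(rK x) -{2}(rK x) !actq tg_mulA.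
- move=> [g x] U /= nU; rewrite -(rK x) actq in nU.
  have [A [B [nA nB ABU]]] := tg_mul_nbhs (q_cont _ _ nU).
  exists (A, q @` B) => /=.
    by split => //=; rewrite -(rK x); exact: q_nbhs.
  by move=> [c _] [/= Ac [b Bb <-]]; rewrite actq; exact: ABU.
- move=> x y; exists (tg_mul (r y) (tg_inv (r x))).
  by rewrite -{2}(rK x) actq -tg_mulA tg_mulV tg_mulr1.
- move=> x O nO; rewrite -(rK x).
  have nOr : nbhs (r x) [set a | O (tg_mul a (tg_inv (r x)))].
    by apply: tg_mulr_cont; rewrite tg_mulVr.
  apply: filterS (q_nbhs _ _ nOr) => _ [a Oa <-]; apply: subset_closure.
  exists (tg_mul a (tg_inv (r x))) => //.
  by rewrite actq -tg_mulA tg_mulV tg_mulr1.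
Qed.

(** The sets [Q n] are traces of neighbourhoods whose closures lie in [W n]. The limit of the
    ultrafilter in the compactification then lies in every [W n], hence in the embedded space. *)
Lemma cech_complete_ultra_cvg (H : topologicalType) (e : H) : cech_complete H ->
  exists Q : nat -> set H, (forall n, nbhs e (Q n)) /\
    forall (T : Type) (F : set_system T) (h : T -> H), UltraFilter F ->
      (forall n, F (h @^-1` Q n)) -> exists y : H, h @ F --> y.
Proof.
case=> K [i [[Kc Kh _ i_cont i_emb] [_ [W [oW iW]]]]].
have We n : W n (i e) by have : range i (i e) by [exists e]; rewrite iW; exact.
have /choice[V VP] n : exists V : set K, nbhs (i e) V /\ closure V `<=` W n.
  have [|V nV VW] := @compact_regular_nbhs K (i e) (W n) Kc Kh; last by exists V.
  exact: open_nbhs_nbhs.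
exists (fun n => i @^-1` V n); split=> [n|T F h FU FV].
  by apply: i_cont; have [] := VP n.
have [k Fk] := compact_ultra_image_cvg (i \o h) Kc FU.
have : range i k.
  rewrite iW => n _; apply: (VP n).2 => B nB.
  by have [t [Vt Bt]] := filter_ex (filterI (FV n) (Fk _ nB)); exists t.
case=> y _ yk; exists y => U; rewrite nbhsE => -[U' [oU' U'y] U'U].
have [V' [oV' V'E]] := i_emb _ oU'.
have nV' : nbhs k V'.
  by apply: open_nbhs_nbhs; split => //; rewrite -yk -[V' _]/((i @^-1` V') y) V'E.
have FV' : F (h @^-1` U') by rewrite -V'E; exact: Fk _ nV'.
by apply: filterS FV' => t; exact: U'U.
Qed.

(** * Neighbourhoods in products and cylinder filters *)

Lemma prod_nbhs_cylinder (I : choiceType) (F : I -> topologicalType)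
    (p : prod_topology F) (A : set (prod_topology F)) : nbhs p A ->
  exists (l : seq I) (N : forall i, set (F i)), (forall i, nbhs (p i) (N i)) /\
    forall q : prod_topology F, (forall i, i \in l -> N i (q i)) -> A q.
Proof.
(* The cylinder neighbourhoods form a filter, and its convergence to [p] can be tested one
   coordinate at a time. *)
pose C : set_system (prod_topology F) := [set A | exists (l : seq I)
  (N : forall i, set (F i)), (forall i, nbhs (p i) (N i)) /\
  forall q : prod_topology F, (forall i, i \in l -> N i (q i)) -> A q].
have CF : Filter C.
  split.
  - by exists [::], (fun=> setT); split => // i; exact: filterT.
  - move=> A1 A2 [l1 [N1 [nN1 lA1]]] [l2 [N2 [nN2 lA2]]].
    exists (l1 ++ l2), (fun i => N1 i `&` N2 i); split.
      by move=> i; exact: filterI.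
    move=> q qN; split; [apply: lA1 | apply: lA2] => i il;
    by have [] := qN i; rewrite // mem_cat il ?orbT.
  - move=> A1 A2 A12 [l [N [nN lA]]]; exists l, N; split => // q qN.
    exact/A12/lA.
suff : C --> p by apply.
apply/cvg_sup => i U; rewrite nbhsE => -[V [[V' oV' <-] V'p] VU].
(* The family must be defined at every [j]: the cast transports [y] when [i = j], and the condition
   is vacuous otherwise. *)
exists [:: i], (fun j => [set y | forall ij : i = j, V' (ecast k (F k) (esym ij) y)]).
split=> [j|q]; last first.
  by move=> qN; apply: VU; exact: qN i (mem_head _ _) erefl.
have [ij|ij] := pselect (i = j).
  case: j / ij; apply: filterS (open_nbhs_nbhs (conj oV' V'p)) => y V'y ij.
  by rewrite (eq_irrelevance ij erefl).
by apply: filterS filterT => y _ ij'; case: (ij ij').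
Qed.

Section cylinders.
Variables (G : topGroup) (I : choiceType) (F : I -> topGroup).
Variable f : G -> prod_topology (fun i => tg_car (F i)).
Hypothesis f_mul : forall a b i, f (tg_mul a b) i = tg_mul (f a i) (f b i).

(** These are the neighbourhoods of the unit in the possibly non-Hausdorff group topology induced by
    the coordinates in [A]. *)
Definition cylinder_filter (A : set I) : set_system G :=
  [set O | exists (l : seq I) (N : forall i, set (F i)),
    [/\ forall i, i \in l -> A i, forall i, nbhs (tg_one (F i)) (N i) &
        forall g, (forall i, i \in l -> N i (f g i)) -> O g]].

Let f1 i : f (tg_one G) i = tg_one (F i).
Proof. by apply: tg_idem; rewrite -f_mul tg_mul1. Qed.

Let fV a i : f (tg_inv a) i = tg_inv (f a i).
Proof. by apply: tg_inv_unique; rewrite -f_mul tg_mulV f1. Qed.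

Lemma cylinder_filter_filter A : Filter (cylinder_filter A).
Proof.
split.
- by exists [::], (fun=> setT); split => // i; exact: filterT.
- move=> O1 O2 [l1 [N1 [lA1 nN1 lO1]]] [l2 [N2 [lA2 nN2 lO2]]].
  exists (l1 ++ l2), (fun i => N1 i `&` N2 i); split.
  + by move=> i; rewrite mem_cat => /orP[/lA1|/lA2].
  + by move=> i; exact: filterI.
  + move=> g gN; split; [apply: lO1 | apply: lO2] => i il;
    by have [] := gN i; rewrite // mem_cat il ?orbT.
- move=> O1 O2 O12 [l [N [lA nN lO]]]; exists l, N; split => // g gN.
  exact/O12/lO.
Qed.

Lemma cylinder_filter_mono A B :
  A `<=` B -> cylinder_filter A `<=` cylinder_filter B.
Proof.
by move=> AB O [l [N [lA nN lO]]]; exists l, N; split => // i /lA/AB.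
Qed.

Lemma cylinder_filter_mul A O : cylinder_filter A O ->
  exists2 O', cylinder_filter A O' & forall a b, O' a -> O' b -> O (tg_mul a b).
Proof.
case=> l [N [lA nN lO]].
have /all_sig[N' N'P] i : {N' : set (F i) | nbhs (tg_one (F i)) N' /\
    forall a b, N' a -> N' b -> N i (tg_mul a b)}.
  apply: cid; have := nN i; rewrite -{1}(tg_mul1 (tg_one (F i))).
  move=> /tg_mul_nbhs[A' [B' [nA nB AB]]].
  exists (A' `&` B'); split; first exact: filterI.
  by move=> a b [Aa _] [_ Bb]; exact: AB.
exists [set g | forall i, i \in l -> N' i (f g i)].
  by exists l, N'; split => // i; have [] := N'P i.
move=> a b aN bN; apply: lO => i il; rewrite f_mul.
by apply: (N'P i).2; [exact: aN | exact: bN].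
Qed.

Lemma cylinder_filter_conj A g O : cylinder_filter A O ->
  cylinder_filter A [set a | O (tg_mul (tg_inv g) (tg_mul a g))].
Proof.
case=> l [N [lA nN lO]].
exists l, (fun i => [set a | N i (tg_mul (tg_inv (f g i)) (tg_mul a (f g i)))]).
split => // [i|a aN].
  apply: (@tg_mulr_cont (F i) (f g i) (tg_one (F i))
    [set a | N i (tg_mul (tg_inv (f g i)) a)]).
  rewrite tg_mul1; apply: tg_mull_cont; rewrite tg_mulV; exact: nN.
by apply: lO => i /aN; rewrite !f_mul fV.
Qed.

Lemma cylinder_filter_nbhs A O : continuous f ->
  cylinder_filter A O -> nbhs (tg_one G) O.
Proof.
move=> f_cont [l [N [lA nN lO]]]; apply: filterS lO _.
apply: filter_seqI => i _.
have nNp : nbhs (proj i (f (tg_one G))) (N i) by rewrite /proj f1; exact: nN.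
exact: f_cont (@proj_continuous I F i _ _ nNp).
Qed.

Lemma nbhs_cylinder_filter O :
  (forall U : set G, open U ->
    exists V : set (prod_topology (fun i => tg_car (F i))),
      open V /\ f @^-1` V = U) ->
  nbhs (tg_one G) O ->
  exists l : seq I, cylinder_filter [set` l] O.
Proof.
move=> f_emb; rewrite nbhsE => -[U [oU U1] UO].
have [V [oV VU]] := f_emb _ oU.
have nV : nbhs (f (tg_one G)) V.
  by apply: open_nbhs_nbhs; split => //; rewrite -[V _]/((f @^-1` V) _) VU.
have [l [N [nN lV]]] := prod_nbhs_cylinder nV.
exists l, l, N; split => // [i|g gN]; first by rewrite -f1.
by apply: UO; rewrite -VU; exact: lV.
Qed.

Hypothesis F_cech : forall i, cech_complete (F i).

(** [P] enumerates [E] together with the sets that force convergence in each coordinate of [A]; the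
    Cauchy condition for one [O] involves finitely many of these coordinates. *)
Lemma cylinder_filter_cauchy_seq (A : set I) (E : set (set G)) :
  countable A -> countable E -> E `<=` cylinder_filter A ->
  exists P : nat -> set G, [/\ forall n, cylinder_filter A (P n),
    forall O, E O -> exists n, P n = O &
    forall (T : Type) (Phi : set_system T) (w : T -> G), UltraFilter Phi ->
      (forall n, Phi (w @^-1` P n)) -> forall O, cylinder_filter A O ->
      exists2 B : set G, Phi (w @^-1` B) &
        forall a b, B a -> B b -> O (tg_mul a (tg_inv b))].
Proof.
move=> Ac Ec EA.
have /all_sig[Q QP] i := cid (cech_complete_ultra_cvg (tg_one (F i)) (F_cech i)).
(* [setT] makes [C] nonempty, hence the range of a sequence. *)
pose C := E `|` [set setT] `|`
  \bigcup_(i in A) [set [set g | Q i n (f g i)] | n in setT].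
have CA : C `<=` cylinder_filter A.
  move=> O [[/EA //|->]|[i Ai [n _ <-]]].
    by apply: filterT; exact: cylinder_filter_filter.
  exists [:: i], (fun j => Q j n); split.
  - by move=> j; rewrite inE => /eqP ->.
  - by move=> j; have [] := QP j.
  - by move=> g; apply; rewrite inE.
have Cc : countable C.
  rewrite /C; apply: countable_setU; first exact: countable_setU.
  by apply: bigcup_countable => // i _; exact: card_image_le.
have [P PC] := @countable_range _ C setT (or_introl (or_intror erefl)) Cc.
have CP O : C O -> exists n, P n = O by rewrite -PC => -[n _ <-]; exists n.
exists P; split.
- by move=> n; apply: CA; rewrite -PC; exists n.
- by move=> O EO; apply: CP; left; left.
move=> T Phi w PhiU PhiP O [l [N [lA nN lO]]].
have /all_sig[N' N'P] i : {N' : set (F i) |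
    (i \in l -> Phi [set t | N' (f (w t) i)]) /\
    forall a b, N' a -> N' b -> N i (tg_mul a (tg_inv b))}.
  (* Off [l] the empty set satisfies both conditions vacuously. *)
  apply: cid; have [il|il] := boolP (i \in l); last by exists set0.
  have [|y Phiy] := (QP i).2 T Phi (fun t => f (w t) i) PhiU.
    move=> n; have [|m Pm] := CP [set g | Q i n (f g i)].
      by right; exists i; [exact: lA | exists n].
    by have := PhiP m; rewrite Pm.
  have [N' nN' N'N] := tg_div_nbhs y (nN i).
  by exists N'; split => // _; exact: Phiy.
exists [set g | forall i, i \in l -> N' i (f g i)].
  by apply: filter_seqI => i il; exact: (N'P i).1.
move=> a b aN bN; apply: lO => i il; rewrite f_mul fV.
by apply: (N'P i).2; [exact: aN | exact: bN].
Qed.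

End cylinders.

(** * From groups to metrizability *)

Lemma dopen_action_metrizable (X : topologicalType) (G : topGroup) :
  compact [set: X] -> hausdorff_space X -> countable_character X ->
  subgroup_of_prod_cech G -> cont_trans_dopen_action G X -> metrizable X.
Proof.
move=> Xc Xh Xcc [I0 [F0 [f [F_cech f_mul _ f_cont f_emb]]]].
case=> act [act1 actM act_cont act_trans act_dopen].
(* The empty space has no base point and is treated apart. *)
have [[x0 _]|X0] := pselect (exists x : X, True); last first.
  have noX (x : X) : False by apply: X0; exists x.
  exists (fun _ _ => 0); split => //; try by move=> x; have := noX x.
  by move=> U; split=> [_ x|_]; [have := noX x|rewrite openE => x; have := noX x].
(* The classical structure on indices gives meaning to membership in finite lists of coordinates. *)
pose I : choiceType := {classic I0}; pose F : I -> topGroup := F0.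
have actg_cont g : continuous (act g).
  move=> x; apply: (cvg_comp (fun x => (g, x)) (fun p => act p.1 p.2) _
    (act_cont (g, x))).
  by apply: cvg_pair; [exact: cvg_cst | exact: cvg_id].
have [B [Bc B_nbhs B_base]] := Xcc x0.
(* Continuity at the unit and [x0] gives each basic [b] a set of group elements that is determined
   by a finite list of coordinates; outside [B] the value is a dummy. *)
have /choice[lO lOP] (b : set X) : exists lO : seq I * set G, B b ->
    cylinder_filter (F := F) f [set` lO.1] lO.2 /\
    forall g, lO.2 g -> b (act g x0).
  have [Bb|nBb] := pselect (B b); last by exists ([::], setT).
  have [ob bx0] := B_nbhs b Bb.
  have nb : nbhs (act (tg_one G) x0) b by rewrite act1; exact: open_nbhs_nbhs.
  have [[O M] /= [nO nM] OMb] := act_cont (tg_one G, x0) _ nb.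
  have [l lO] := @nbhs_cylinder_filter G I F f f_mul O f_emb nO.
  exists (l, O) => _; split => // g Og; apply: (OMb (g, x0)); split => //=.
  exact: nbhs_singleton nM.
pose A : set I := \bigcup_(b in B) [set` (lO b).1].
have [||O [b Bb <-]|P [PN PE P_cauchy]] :=
    @cylinder_filter_cauchy_seq G I F f f_mul F_cech A [set (lO b).2 | b in B].
- by apply: bigcup_countable => // b _; exact: finite_set_countable.
- exact: card_le_trans (card_image_le _ _) Bc.
- by apply: cylinder_filter_mono (lOP b Bb).1 => i il; exists b.
have [b [b_open b_base]] : exists b : nat -> set X, (forall n, open (b n)) /\
    forall x U, open U -> U x -> exists2 n, b n x & b n `<=` U.
  apply: (@dopen_countable_base G X act (cylinder_filter (F := F) f A) x0 P) => //.
  - exact: cylinder_filter_filter.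
  - exact: cylinder_filter_mul.
  - exact: cylinder_filter_conj.
  - by move=> x O /cylinder_filter_nbhs nO; apply: act_dopen; exact: nO.
  - move=> U /B_base[b Bb bU]; have [|n Pn] := PE (lO b).2; first by exists b.
    by exists n => g; rewrite Pn => /(lOP b Bb).2/bU.
  - by move=> Phi PhiU PhiP O NO; exact: (P_cauchy _ Phi fst PhiU PhiP O NO).
exact: compact_countable_base_metrizable b_open b_base.
Qed.

Theorem theorem4p8 (X : topologicalType) :
  compact [set: X] -> hausdorff_space X -> countable_character X ->
  (exists G : topGroup, subgroup_of_prod_cech G /\
     (coset_space_of X G \/ cont_trans_dopen_action G X)) ->
  metrizable X.
Proof.
move=> Xc Xh Xcc [G [Gcech [/coset_space_action|] Gact]];
exact: dopen_action_metrizable Gcech Gact.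
Qed.
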